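(* Let $G=(V,E)$ be a finite connected graph with $n=|V|$ vertices and arbitrary positive edge rates $(r_e:e\in E)$, and let $\mathcal L$ be the generator of the single random walk $\mathrm{RW}(1)$. Let $\lambda>0$ be an eigenvalue of $-\mathcal L$ and $f\ne0$ a corresponding eigenfunction. If $\varepsilon,\delta\in(0,1/4)$ and $k\le n/2$ are such that $\|f\|_1\ge k^{-1/4+\delta}\|f\|_2$ and $4\delta\log k-\log(16/\varepsilon)\ge0$, then $$t_{\mathrm{mix}}^{\mathrm{EX}(k)}(1-\varepsilon)\ge\frac{1}{2\lambda}\bigl(4\delta\log k-\log(16/\varepsilon)\bigr).$$
   Context: Each edge $e$ rings at the times of an independent rate-$r_e$ Poisson process. $\mathrm{EX}(k)$ (symmetric exclusion process with $k$ particles): continuous-time Markov chain on $k$-subsets of $V$ (occupied sites); when $e$ rings, the contents (occupied/vacant) of the endpoints of $e$ are swapped. Its stationary law is uniform on $\binom Vk$. $t_{\mathrm{mix}}^{\mathrm{EX}(k)}(\eta)$ is the least $t$ such that, from every initial state, the law at time $t$ is within total variation distance $\eta$ of the stationary law. $\mathrm{RW}(1)$ is the continuous-time random walk on $V$ that jumps across each incident edge $e$ at rate $r_e$. With $\pi$ uniform on $V$, $\|f\|_p^p=\sum_{x\in V}\pi(x)|f(x)|^p$ for $f\in\mathbb R^V$. *)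

(* Defs.v *)
From mathcomp Require Import all_boot all_order all_algebra all_fingroup.
From mathcomp Require Import all_classical all_reals all_analysis.
Set Implicit Arguments.
Unset Strict Implicit.
Unset Printing Implicit Defensive.
Import Order.TTheory GRing.Theory Num.Theory.
Import numFieldNormedType.Exports.
Local Open Scope classical_set_scope.
Local Open Scope ring_scope.

(* A Markov chain on a finite state space S is given by its generator          *)
(*   L F x = \sum_y q(x, y) (F y - F x),  q(x, y) = jump rate from x to y,     *)
(* acting on functions F : S -> R.                                             *)

(* (e^{tL} F)(x), as the sum over m of t^m / m! * (L^m F)(x). *)
Definition semigroup (R : realType) (S : finType) (L : (S -> R) -> (S -> R))
    (t : R) (F : S -> R) (x : S) : R :=
  limn (series (fun m : nat => exp_coeff t m * iter m L F x)).

(* P(X_t = y | X_0 = x) for the chain with generator L. *)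
Definition law_at (R : realType) (S : finType) (L : (S -> R) -> (S -> R))
    (t : R) (x : S) : S -> R :=
  fun y => semigroup L t (fun z => (z == y)%:R) x.

Definition uniform_law (R : realType) (S : finType) : S -> R :=
  fun=> #|S|%:R^-1.

Definition tv_dist (R : realType) (S : finType) (mu nu : S -> R) : R :=
  \big[Num.max/0]_(B : {set S}) `|\sum_(x in B) mu x - \sum_(x in B) nu x|.

(* Mixing time of a chain whose stationary law is uniform; +oo if there is no  *)
(* t as required.                                                              *)
Definition mixing_time (R : realType) (S : finType)
    (L : (S -> R) -> (S -> R)) (eta : R) : \bar R :=
  ereal_inf [set t%:E | t in
    [set t : R | 0 <= t /\
       forall x : S, tv_dist (law_at L t x) (@uniform_law R S) <= eta]].

(* In the graph definitions below, e is the adjacency relation and r x y the   *)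
(* rate of the edge {x, y}; the values of r off the edges are never used.      *)

Definition RW_generator (R : realType) (V : finType) (e : rel V)
    (r : V -> V -> R) (f : V -> R) : V -> R :=
  fun x => \sum_(y | e x y) r x y * (f y - f x).

Notation config V k := {A : {set V} | #|A| == k}.

Lemma swap_card (V : finType) (k : nat) (x y : V) (A : config V k) :
  #|tperm x y @: val A| == k.
Proof. by rewrite card_imset ?(valP A)//; exact: perm_inj. Qed.

(* The occupied set after exchanging the contents of x and y. *)
Definition swap (V : finType) (k : nat) (x y : V) (A : config V k) :
    config V k :=
  Sub (tperm x y @: val A) (swap_card x y A).

(* Every edge {x, y} occurs in the sum as (x, y) and as (y, x), hence 1/2. *)
Definition EX_generator (R : realType) (V : finType) (e : rel V)
    (r : V -> V -> R) (k : nat) (F : config V k -> R) : config V k -> R :=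
  fun A => 2^-1 * \sum_x \sum_(y | e x y) r x y * (F (swap x y A) - F A).

Definition tmix_EX (R : realType) (V : finType) (e : rel V)
    (r : V -> V -> R) (k : nat) (eta : R) : \bar R :=
  mixing_time (@EX_generator R V e r k) eta.

(* L^p norm with respect to the uniform probability measure on V. *)
Definition Lpnorm (R : realType) (V : finType) (p : R) (f : V -> R) : R :=
  (\sum_x @uniform_law R V x * `|f x| `^ p) `^ p^-1.

(* Main.v *)
Require Import Defs.
From mathcomp Require Import all_boot all_order all_algebra all_fingroup.
From mathcomp Require Import all_classical all_reals all_analysis.
From mathcomp Require Import ring lra zify.
Set Implicit Arguments.
Unset Strict Implicit.
Unset Printing Implicit Defensive.
Import Order.TTheory GRing.Theory Num.Theory.
Import numFieldNormedType.Exports.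
Local Open Scope classical_set_scope.
Local Open Scope ring_scope.

(** Write [F A] for the sum of [f] over the occupied sites, [G A] for the sum
    of [f ^ 2] over them, and [mu] for the law of the exclusion process at time
    [t] started from [A]. The theorem is a second moment bound.

    - Since [F] is a sum of one-particle functions, the exclusion generator acts
      on it as the random walk generator does on [f]; so [F] is an eigenfunction
      and its mean under [mu] is [m = e^(- lambda t) F(A)].

    - The off-diagonal part [H = F ^ 2 - G] of the square satisfies
      [L H <= - 2 lambda H] pointwise ([EX_pair_sum]): in the carre du champ of
      [F] the edges with both endpoints occupied do not contribute, whereas for
      independent particles they would. Positivity of the semigroup turns this
      into [P_t H <= e^(- 2 lambda t) H], hence the variance of [F] under [mu]
      is at most [P_t G (A)], the sum over [A] of [w], where [w] is the random
      walk semigroup applied to [f ^ 2] ([EX_variance]). This is the negative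
      dependence of the exclusion process, in the only form needed. Summing
      [L H <= - 2 lambda H] over all states, where the left side cancels, gives
      the stationary counterpart: the mean of [F ^ 2] is at most
      [k / n * sum f ^ 2] ([sum_occ_sum_sqr_le]).

    - Two laws whose overlap is [1 - tv] cannot both concentrate [F], one
      around [m] and the other around [0], unless [(1 - tv) m ^ 2] is at most
      twice the sum of the two second moments ([tv_dist_second_moment]).

    - It remains to choose [A] with [F(A) ^ 2] large compared with the sum of
      [w] over [A]. Among [{f >= 0}] and [{f < 0}] one set [S] has at least [k]
      elements, and both carry half of the l1 norm of [f] because [f] has mean
      zero. A uniform [k]-subset of [S] would do on average; bounding [F ^ 2]
      below by its tangent at the mean makes the requirement linear in [A], so
      that a [k]-subset of [S] of at least average weight suffices
      ([exists_good_start]).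

    Positivity of [e^(tL)] is obtained from the series: [L + c] preserves
    inequalities for large [c], and [e^(t(L + c)) = e^(tc) e^(tL)] by the
    Cauchy product theorem. *)

(** * Cauchy products *)

Definition cauchy_product (R : realType) (a b : nat -> R) (m : nat) : R :=
  \sum_(0 <= i < m.+1) a i * b (m - i)%N.

Lemma series_cauchy_product (R : realType) (a b : nat -> R) (N : nat) :
  series (cauchy_product a b) N = \sum_(0 <= i < N) a i * series b (N - i)%N.
Proof.
elim: N => [|N IH]; first by rewrite /series/= !big_geq.
rewrite seriesSr IH.
have -> : \sum_(0 <= i < N) a i * series b (N - i)%N =
          \sum_(0 <= i < N.+1) a i * series b (N - i)%N.
  have b0 : series b 0 = 0 by rewrite /series/= big_geq.
  by rewrite big_nat_recr//= subnn b0 mulr0 addr0.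
rewrite -big_split/= !big_nat; apply: eq_bigr => i; rewrite ltnS => /andP[_ iN].
by rewrite -mulrDr subSn// /series/= big_nat_recr.
Qed.

(** For nonnegative terms, the triangle [i + j < n] lies inside the square
    [i, j < n], and the triangle of size [2 n] contains that square. *)
Lemma cvg_series_cauchy_product_ge0 (R : realType) (a b : nat -> R) :
  (forall n, 0 <= a n) -> (forall n, 0 <= b n) ->
  cvgn (series a) -> cvgn (series b) ->
  series (cauchy_product a b) @ \oo --> limn (series a) * limn (series b).
Proof.
move=> a0 b0 ca cb.
have mono (u : nat -> R) : (forall n, 0 <= u n) -> nondecreasing_seq (series u).
  by move=> u0; apply: nondecreasing_series => n _ _; exact: u0.
have series_ge0 (u : nat -> R) n : (forall n, 0 <= u n) -> 0 <= series u n.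
  by move=> u0; rewrite /series/=; apply: sumr_ge0 => i _; exact: u0.
have conv_ge0 n : 0 <= cauchy_product a b n.
  by apply: sumr_ge0 => i _; rewrite mulr_ge0.
have cab : (fun n => series a n * series b n) @ \oo -->
    limn (series a) * limn (series b) by exact: cvgM.
have ub n : series (cauchy_product a b) n <= series a n * series b n.
  rewrite series_cauchy_product [in leRHS]/series/= mulr_suml.
  apply: ler_sum => i _; apply: ler_wpM2l => //.
  by apply: (mono _ b0); exact: leq_subr.
have lb n : series a n * series b n <= series (cauchy_product a b) (2 * n)%N.
  rewrite series_cauchy_product (_ : series a n * _ = \sum_(0 <= i < n) a i * series b n);
    last by rewrite -mulr_suml.
  rewrite [in leRHS](@big_cat_nat _ _ _ n)//=; last by lia.
  rewrite -[leLHS]addr0; apply: lerD; last first.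
    by apply: sumr_ge0 => i _; rewrite mulr_ge0// series_ge0.
  rewrite !big_nat; apply: ler_sum => i /andP[_ i_n]; apply: ler_wpM2l => //.
  by apply: (mono b b0); lia.
have cc : cvgn (series (cauchy_product a b)).
  apply: nondecreasing_is_cvgn; first exact: mono.
  exists (limn (series a) * limn (series b)) => _ [n _ <-].
  apply: (le_trans (ub n)); apply: ler_pM; rewrite ?series_ge0//.
  - by apply: nondecreasing_cvgn_le => //; exact: mono.
  - by apply: nondecreasing_cvgn_le => //; exact: mono.
have /cvg_lim <- // := cab.
suff -> : limn (fun n => series a n * series b n) = limn (series (cauchy_product a b)) by [].
apply/le_anti/andP; split.
- apply: limr_le; first exact: cvgP cab.
  apply: nearW => n; apply: (le_trans (lb n)).
  by apply: nondecreasing_cvgn_le => //; exact: mono.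
- by apply: ler_lim; [|exact: cvgP cab|exact: nearW].
Qed.

(** The part of the square outside the triangle is bounded by the same part for
    the absolute values, which vanishes in the limit by the nonnegative case. *)
Lemma cvg_series_cauchy_product (R : realType) (a b : nat -> R) :
  cvgn [normed series a] -> cvgn [normed series b] ->
  series (cauchy_product a b) @ \oo --> limn (series a) * limn (series b).
Proof.
move=> na nb.
set a' := fun n => `|a n|; set b' := fun n => `|b n|.
have cab : (fun n => series a n * series b n) @ \oo -->
    limn (series a) * limn (series b) by apply: cvgM; exact: normed_cvg.
have c' := @cvg_series_cauchy_product_ge0 R a' b' (fun=> normr_ge0 _) (fun=> normr_ge0 _) na nb.
have cab' : (fun n => series a' n * series b' n) @ \oo -->
    limn (series a') * limn (series b') by exact: cvgM.
have d' : (fun n => series a' n * series b' n - series (cauchy_product a' b') n) @ \oo --> (0 : R).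
  by rewrite -[0](subrr (limn (series a') * limn (series b'))); exact: cvgB.
suff d : (fun n => series a n * series b n - series (cauchy_product a b) n) @ \oo --> (0 : R).
  rewrite (_ : series _ = (fun n => series a n * series b n -
    (series a n * series b n - series (cauchy_product a b) n))); last first.
    by apply/funext => n; rewrite opprB addrC subrK.
  by rewrite -[X in _ --> X]subr0; exact: cvgB.
apply/cvgr0Pnorm_lt => eps eps0.
have /cvgr0Pnorm_lt /(_ _ eps0) := d'.
apply: filterS => n; apply: le_lt_trans; apply: le_trans (ler_norm _).
rewrite !series_cauchy_product {1 3}/series/= !mulr_suml -!sumrB.
apply: (le_trans (ler_norm_sum _ _ _)); apply: ler_sum => i _.
rewrite -!mulrBr normrM; apply: ler_wpM2l => //.
rewrite !sub_series_geq ?leq_subr//; exact: ler_norm_sum.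
Qed.

(** * The semigroup of a linear operator on a finite state space *)

Definition linear_op (R : realType) (S : finType) (L : (S -> R) -> S -> R) :=
  forall (a : R) F G,
    L (fun x => a * F x + G x) = (fun x => a * L F x + L G x).

Lemma linear_op0 (R : realType) (S : finType) (L : (S -> R) -> S -> R) :
  linear_op L -> L (fun=> 0) = (fun=> 0).
Proof.
move=> Llin; have := Llin (-1) (fun=> 0) (fun=> 0).
rewrite mulr0 addr0 => E; apply/funext => x.
by move/(congr1 (@^~ x)): E => /= ->; rewrite mulN1r addNr.
Qed.

Lemma linear_op_sum (R : realType) (S T : finType) (L : (S -> R) -> S -> R)
    (a : T -> R) (F : T -> S -> R) :
  linear_op L ->
  L (fun x => \sum_y a y * F y x) = (fun x => \sum_y a y * L (F y) x).
Proof.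
move=> Llin; elim: (index_enum T) => [|y s IH].
  under [in LHS]eq_fun do rewrite big_nil.
  by under [in RHS]eq_fun do rewrite big_nil; exact: linear_op0.
under [in LHS]eq_fun do rewrite big_cons.
by under [in RHS]eq_fun do rewrite big_cons; rewrite Llin IH.
Qed.

Lemma linear_op_iter (R : realType) (S : finType) (L : (S -> R) -> S -> R) m :
  linear_op L -> linear_op (fun F => iter m L F).
Proof. by move=> Llin a F G; elim: m => //= m ->; rewrite Llin. Qed.

Lemma sum_indicator (R : realType) (S : finType) (F : S -> R) :
  F = (fun x => \sum_y F y * (x == y)%:R).
Proof.
apply/funext => x; rewrite (bigD1 x)//= eqxx mulr1 big1 ?addr0// => y.
by rewrite eq_sym => /negbTE ->; rewrite mulr0.
Qed.

Lemma linear_op_bounded (R : realType) (S : finType) (L : (S -> R) -> S -> R) :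
  linear_op L -> exists2 M : R, 0 <= M &
    forall F B, (forall y, `|F y| <= B) -> forall x, `|L F x| <= M * B.
Proof.
move=> Llin.
exists (\sum_x \sum_y `|L (fun z => (z == y)%:R) x|).
  by apply: sumr_ge0 => x _; exact: sumr_ge0.
move=> F B FB x; rewrite {1}(sum_indicator F) linear_op_sum// [in leRHS](bigD1 x)//=.
have B0 : 0 <= B := le_trans (normr_ge0 _) (FB x).
rewrite mulrDl -[leLHS]addr0; apply: lerD; last first.
  by rewrite mulr_ge0//; apply: sumr_ge0 => z _; exact: sumr_ge0.
rewrite mulr_suml; apply: (le_trans (ler_norm_sum _ _ _)).
by apply: ler_sum => y _; rewrite normrM mulrC ler_wpM2l.
Qed.

Lemma cvg_series_expMr (R : realType) (s b : R) :
  series (fun m => exp_coeff s m * b) @ \oo --> expR s * b.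
Proof.
rewrite (_ : series _ = fun n => series (exp_coeff s) n * b).
  by apply: cvgMr_tmp; exact: is_cvg_series_exp_coeff.
by apply/funext => n; rewrite /series/= mulr_suml.
Qed.

(** A linear operator on a finite-dimensional space is bounded by some [M], so
    the series is dominated by that of [exp (|t| M)]. *)
Lemma semigroup_cvg (R : realType) (S : finType) (L : (S -> R) -> S -> R)
    (t : R) (F : S -> R) (x : S) :
  linear_op L -> cvgn [normed series (fun m => exp_coeff t m * iter m L F x)].
Proof.
move=> /linear_op_bounded[M M0 LM].
pose B := \sum_y `|F y|.
have FB y : `|F y| <= B.
  by rewrite /B (bigD1 y)//= lerDl; exact: sumr_ge0.
have iterB m : forall y, `|iter m L F y| <= M ^+ m * B.
  elim: m => [|m IH] y; first by rewrite expr0 mul1r.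
  by rewrite /= exprS -mulrA; exact: LM.
have B0 : 0 <= B by apply: sumr_ge0.
apply: (@series_le_cvg _ _ (fun m => exp_coeff (`|t| * M) m * B)) => //.
- by move=> m /=.
- by move=> m; apply: mulr_ge0 => //; apply: exp_coeff_ge0; exact: mulr_ge0.
- move=> m; rewrite /exp_coeff/= normrM normf_div normrX normr_nat exprMn.
  rewrite [leRHS](_ : _ = `|t| ^+ m / m`!%:R * (M ^+ m * B)); last by ring.
  by apply: ler_wpM2l => //; rewrite mulr_ge0// ?exprn_ge0.
- exact: cvgP (@cvg_series_expMr R (`|t| * M) B).
Qed.

Lemma lim_series_sum (R : realType) (T : finType) (a : T -> R)
    (u : T -> nat -> R) :
  (forall y, cvgn (series (u y))) ->
  limn (series (fun m => \sum_y a y * u y m)) = \sum_y a y * limn (series (u y)).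
Proof.
move=> cu; apply: cvg_lim => //.
rewrite (_ : series _ = fun n => \sum_y a y * series (u y) n).
  apply: cvg_big => [|y _]; first exact: add_continuous.
  by apply: cvgMl_tmp; exact: cu.
apply/funext => n; rewrite /series/= exchange_big/=.
by apply: eq_bigr => y _; rewrite mulr_sumr.
Qed.

Lemma semigroup_sum (R : realType) (S T : finType) (L : (S -> R) -> S -> R)
    (t : R) (a : T -> R) (F : T -> S -> R) (x : S) :
  linear_op L ->
  semigroup L t (fun z => \sum_y a y * F y z) x =
  \sum_y a y * semigroup L t (F y) x.
Proof.
move=> Llin; rewrite /semigroup -lim_series_sum; last first.
  by move=> y; exact/normed_cvg/semigroup_cvg.
congr (limn (series _)); apply/funext => m.
rewrite (linear_op_sum _ _ (linear_op_iter m Llin)) mulr_sumr.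
by apply: eq_bigr => y _; rewrite mulrCA.
Qed.

(** Used with [w] the incidence of sites and configurations, and with [w = 1]
    towards a one-point space, where it says that the uniform measure is
    stationary. *)
Lemma semigroup_intertwine (R : realType) (S T : finType)
    (L : (S -> R) -> S -> R) (L' : (T -> R) -> T -> R) (w : T -> S -> R)
    (t : R) (F : S -> R) (z : T) :
  linear_op L ->
  (forall G, L' (fun y => \sum_x w y x * G x) = (fun y => \sum_x w y x * L G x)) ->
  semigroup L' t (fun y => \sum_x w y x * F x) z =
  \sum_x w z x * semigroup L t F x.
Proof.
move=> Llin L'L; rewrite /semigroup -lim_series_sum; last first.
  by move=> y; exact/normed_cvg/semigroup_cvg.
congr (limn (series _)); apply/funext => m.
rewrite (_ : iter m L' _ = fun y => \sum_x w y x * iter m L F x).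
  by rewrite mulr_sumr; apply: eq_bigr => y _; rewrite mulrCA.
by elim: m => //= m ->; rewrite L'L.
Qed.

Lemma law_at_expectation (R : realType) (S : finType) (L : (S -> R) -> S -> R)
    (t : R) (F : S -> R) (x : S) :
  linear_op L -> \sum_y law_at L t x y * F y = semigroup L t F x.
Proof.
move=> Llin; rewrite [in RHS](sum_indicator F) semigroup_sum//.
by apply: eq_bigr => y _; rewrite mulrC.
Qed.

Lemma semigroup_eigen (R : realType) (S : finType) (L : (S -> R) -> S -> R)
    (t a : R) (F : S -> R) (x : S) :
  linear_op L -> L F = (fun y => a * F y) ->
  semigroup L t F x = expR (t * a) * F x.
Proof.
move=> Llin LF.
have iterE m : iter m L F = (fun y => a ^+ m * F y).
  elim: m => [|m IH]; first by apply/funext => y; rewrite expr0 mul1r.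
  rewrite /= IH; have := Llin (a ^+ m) F (fun=> 0); rewrite linear_op0// LF.
  under [in LHS]eq_fun do rewrite addr0.
  by move=> ->; apply/funext => y; rewrite addr0 exprS mulrCA mulrA.
rewrite -(cvg_lim _ (@cvg_series_expMr R (t * a) (F x)))// /semigroup.
congr (limn (series _)); apply/funext => m.
by rewrite iterE /exp_coeff/= exprMn; ring.
Qed.

Lemma iter_shift (R : realType) (S : finType) (L : (S -> R) -> S -> R)
    (c : R) (F : S -> R) m :
  linear_op L ->
  iter m (fun G y => L G y + c * G y) F =
  (fun x => \sum_(i < m.+1) (c ^+ (m - i) *+ 'C(m, i)) * iter i L F x).
Proof.
move=> Llin; elim: m => [|m IH].
  by apply/funext => x; rewrite big_ord1 bin0 subn0 expr0 mul1r.
rewrite iterS IH; apply/funext => x /=.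
rewrite (linear_op_sum (fun i : 'I_m.+1 => c ^+ (m - i) *+ 'C(m, i))
  (fun i : 'I_m.+1 => iter i L F) Llin).
rewrite [in RHS]big_ord_recl/= bin0 subn0.
under [in RHS]eq_bigr => i _ do rewrite /bump/= add1n subSS binS mulrnDr mulrDl.
rewrite big_split/= addrA [RHS]addrC; congr (_ + _).
rewrite [in RHS]big_ord_recr/= bin_small// mulr0n mul0r addr0.
rewrite big_ord_recl/= bin0 subn0 mulrDr; congr (_ + _); first by rewrite exprS mulrA.
rewrite mulr_sumr; apply: eq_bigr => i _.
by rewrite /bump/= add1n mulrA mulrnAr -exprS subnSK.
Qed.

(** The binomial expansion of [(L + c) ^ m] makes the series on the left the
    Cauchy product of the series of [e^(tL)] and [e^(tc)]. *)
Lemma semigroup_shift (R : realType) (S : finType) (L : (S -> R) -> S -> R)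
    (c t : R) (F : S -> R) (x : S) :
  linear_op L ->
  semigroup (fun G y => L G y + c * G y) t F x = expR (t * c) * semigroup L t F x.
Proof.
move=> Llin; rewrite mulrC /semigroup /expR; apply: cvg_lim => //.
set a := fun m => exp_coeff t m * iter m L F x.
rewrite (_ : series _ = series (cauchy_product a (exp_coeff (t * c)))).
  apply: cvg_series_cauchy_product; first exact: semigroup_cvg.
  by rewrite normed_series_exp_coeff; exact: is_cvg_series_exp_coeff.
congr series; apply/funext => m; rewrite iter_shift// /cauchy_product big_mkord mulr_sumr.
apply: eq_bigr => -[i/= im] _; rewrite ltnS in im.
rewrite /a /exp_coeff/= -{1}(subnKC im) exprD exprMn.
have := bin_fact im => /(congr1 (fun n => n%:R : R)); rewrite !natrM => E.
have f0 n : (n`!%:R : R) != 0 by rewrite pnatr_eq0 -lt0n fact_gt0.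
rewrite -[in LHS]E -mulr_natr.
have b0 : ('C(m, i)%:R : R) != 0 by rewrite pnatr_eq0 -lt0n bin_gt0.
by field; rewrite !f0 b0.
Qed.

(** For the generator of a Markov chain this holds as soon as [c] is at least
    every total jump rate: the matrix of [L + c] has nonnegative entries. *)
Definition shift_monotone (R : realType) (S : finType) (c : R)
    (L : (S -> R) -> S -> R) :=
  forall F G, (forall y, F y <= G y) ->
    forall y, L F y + c * F y <= L G y + c * G y.

(** Monotonicity of [L + c] gives [(L + c) ^ m H <= (c - a) ^ m H] by induction;
    sum the exponential series and divide by [e^(tc)]. *)
Lemma semigroup_decay (R : realType) (S : finType) (L : (S -> R) -> S -> R)
    (c a t : R) (H : S -> R) (x : S) :
  linear_op L -> shift_monotone c L -> a <= c -> 0 <= t ->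
  (forall y, L H y <= - a * H y) ->
  semigroup L t H x <= expR (- (t * a)) * H x.
Proof.
move=> Llin Lmon ac t0 LH.
rewrite -(ler_pM2l (expR_gt0 (t * c))) -semigroup_shift// mulrA -expRD -mulrBr.
set K := fun G y => L G y + c * G y.
have KH m y : iter m K H y <= (c - a) ^+ m * H y.
  elim: m y => [|m IH] y; first by rewrite expr0 mul1r.
  rewrite iterS; apply: (le_trans (Lmon _ _ IH y)).
  have := Llin ((c - a) ^+ m) H (fun=> 0); rewrite linear_op0//.
  under [in X in X -> _]eq_fun do rewrite addr0.
  move=> ->; rewrite addr0 exprSr -!mulrA [c * _]mulrCA -mulrDr.
  apply: ler_wpM2l; first by rewrite exprn_ge0// subr_ge0.
  by rewrite mulrBl lerBrDr addrAC gerDr; have := LH y; rewrite mulNr; lra.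
have c2 : cvgn (series (fun m => exp_coeff t m * iter m K H x)).
  apply/normed_cvg/semigroup_cvg => b F G; apply/funext => y.
  by rewrite /K Llin; ring.
have c3 := @cvg_series_expMr R (t * (c - a)) (H x).
rewrite -(cvg_lim _ c3)//; apply: lim_series_le => //; first exact: cvgP c3.
move=> m; rewrite [leRHS](_ : _ = exp_coeff t m * ((c - a) ^+ m * H x)).
  by apply: ler_wpM2l => //; exact: exp_coeff_ge0.
by rewrite /exp_coeff/= exprMn; ring.
Qed.

(** If [H <= 0] then [(L + c) H <= 0], so [H] decays at rate [c]: its image
    under the semigroup stays nonpositive. Take for [H] the negative of an
    indicator. *)
Lemma law_at_ge0 (R : realType) (S : finType) (L : (S -> R) -> S -> R)
    (c t : R) (x y : S) :
  linear_op L -> shift_monotone c L -> 0 <= t -> 0 <= law_at L t x y.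
Proof.
move=> Llin Lmon t0; pose H z : R := - (z == y)%:R.
have : semigroup L t H x <= expR (- (t * c)) * H x.
  apply: (@semigroup_decay _ _ _ c) => // z.
  have := Lmon H (fun=> 0); rewrite linear_op0// mulr0 addr0 mulNr => h.
  by rewrite -subr_ge0 -oppr_le0 opprB opprK h// => u; rewrite oppr_le0.
rewrite -law_at_expectation// /H.
under eq_bigr do rewrite mulrN; rewrite sumrN mulrN lerN2.
rewrite (bigD1 y)//= eqxx mulr1 big1 ?addr0; last first.
  by move=> z /negbTE ->; rewrite mulr0.
by apply: le_trans; rewrite mulr_ge0// expR_ge0.
Qed.

Lemma law_at_mass (R : realType) (S : finType) (L : (S -> R) -> S -> R)
    (t : R) (x : S) :
  linear_op L -> L (fun=> 1) = (fun=> 0) -> \sum_y law_at L t x y = 1.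
Proof.
move=> Llin L1; under eq_bigr do rewrite -[law_at _ _ _ _]mulr1.
rewrite (law_at_expectation t (fun=> 1))// (@semigroup_eigen _ _ _ _ 0)//.
  by rewrite mulr0 expR0 mul1r.
by rewrite L1; apply/funext => y; rewrite mul0r.
Qed.

(** * Total variation and second moments *)

(** Integrate [m ^ 2 <= 2 (F - m) ^ 2 + 2 F ^ 2] against the overlap
    [min (mu, nu)], whose mass is at least [1 - tv_dist mu nu]. *)
Lemma tv_dist_second_moment (R : realType) (S : finType) (mu nu F : S -> R)
    (m : R) :
  (forall x, 0 <= mu x) -> (forall x, 0 <= nu x) -> \sum_x mu x = 1 ->
  (1 - tv_dist mu nu) * m ^+ 2 <=
  2 * \sum_x mu x * (F x - m) ^+ 2 + 2 * \sum_x nu x * F x ^+ 2.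
Proof.
move=> mu0 nu0 mu1; pose B := [set x | nu x < mu x]%SET.
have tvB : \sum_(x in B) mu x - \sum_(x in B) nu x <= tv_dist mu nu.
  apply: (le_trans (ler_norm _)); rewrite /tv_dist.
  exact: (le_bigmax _ (fun C : {set S} =>
     `|\sum_(x in C) mu x - \sum_(x in C) nu x|)).
pose low x := if x \in B then nu x else mu x.
have low_sum : 1 - tv_dist mu nu <= \sum_x low x.
  rewrite (bigID (mem B))/= in mu1.
  have -> : \sum_x low x = \sum_(x in B) nu x + \sum_(x | x \notin B) mu x.
    rewrite (bigID (mem B))/=; congr (_ + _); apply: eq_bigr => x.
      by rewrite /low => ->.
    by rewrite /low => /negbTE ->.
  by lra.
apply: (@le_trans _ _ (\sum_x low x * m ^+ 2)).
  by rewrite -mulr_suml; apply: ler_wpM2r => //; exact: sqr_ge0.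
rewrite !mulr_sumr -big_split/=; apply: ler_sum => x _.
have l0 : 0 <= low x by rewrite /low; case: ifP.
have [lmu lnu] : low x <= mu x /\ low x <= nu x.
  by rewrite /low; case: ifPn; rewrite inE -?leNgt => h; split => //; exact: ltW.
apply: (@le_trans _ _ (low x * (2 * (F x - m) ^+ 2 + 2 * F x ^+ 2))).
  apply: ler_wpM2l => //; rewrite -subr_ge0.
  rewrite [X in 0 <= X](_ : _ = (2 * F x - m) ^+ 2); last by ring.
  exact: sqr_ge0.
rewrite mulrDr (mulrCA (low x) 2) (mulrCA (low x) 2).
by apply: lerD; apply: ler_wpM2l => //; apply: ler_wpM2r => //; exact: sqr_ge0.
Qed.

Lemma variance_eq (R : realType) (S : finType) (mu F : S -> R) (m : R) :
  \sum_x mu x = 1 -> \sum_x mu x * F x = m ->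
  \sum_x mu x * (F x - m) ^+ 2 = \sum_x mu x * F x ^+ 2 - m ^+ 2.
Proof.
move=> mu1 muF.
have -> : \sum_x mu x * (F x - m) ^+ 2 =
    \sum_x mu x * F x ^+ 2 - 2 * m * \sum_x mu x * F x + m ^+ 2 * \sum_x mu x.
  by rewrite !mulr_sumr -sumrB -big_split/=; apply: eq_bigr => x _; ring.
by rewrite mu1 muF; ring.
Qed.

(** * Particle sums under the exclusion generator *)

(** Written with indicators over all sites, rather than as a sum over [A], so
    that it is a fixed linear map from functions on [V] to functions on the
    configurations, as [semigroup_intertwine] requires. *)
Definition occ_sum (R : realType) (V : finType) (k : nat) (g : V -> R)
    (A : config V k) : R := \sum_x (x \in val A)%:R * g x.

Lemma mem_swap (V : finType) (k : nat) (x y z : V) (A : config V k) :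
  (z \in val (swap x y A)) = (tperm x y z \in val A).
Proof. by rewrite SubK -{1}(tpermK x y z) mem_imset//; exact: perm_inj. Qed.

Lemma occ_sum_swap (R : realType) (V : finType) (k : nat) (g : V -> R) (x y : V)
    (A : config V k) :
  occ_sum g (swap x y A) - occ_sum g A =
  ((x \in val A)%:R - (y \in val A)%:R) * (g y - g x).
Proof.
rewrite /occ_sum -sumrB; have [yx|xy] := eqVneq y x.
  subst y.
  by rewrite !subrr mul0r big1// => z _; rewrite mem_swap tperm1 perm1 subrr.
rewrite (bigD1 x)//= (bigD1 y)//= !mem_swap tpermL tpermR.
rewrite big1 ?addr0; first by ring.
by move=> z /andP[zx zy]; rewrite mem_swap tpermD ?subrr// eq_sym.
Qed.

Lemma EX_linear (R : realType) (V : finType) (e : rel V) (r : V -> V -> R)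
    (k : nat) : linear_op (@EX_generator R V e r k).
Proof.
move=> a F G; apply/funext => A; rewrite /EX_generator mulrCA -mulrDr.
congr (_ * _); rewrite mulr_sumr -big_split/=; apply: eq_bigr => x _.
rewrite mulr_sumr -big_split/=; apply: eq_bigr => y _; ring.
Qed.

Lemma RW_linear (R : realType) (V : finType) (e : rel V) (r : V -> V -> R) :
  linear_op (RW_generator e r).
Proof.
move=> a F G; apply/funext => x; rewrite /RW_generator mulr_sumr -big_split/=.
by apply: eq_bigr => y _; ring.
Qed.

Lemma EX_shift_monotone (R : realType) (V : finType) (e : rel V) (r : V -> V -> R)
    (k : nat) (c : R) :
  (forall x y, e x y -> 0 <= r x y) ->
  2^-1 * \sum_x \sum_(y | e x y) r x y <= c ->
  shift_monotone c (@EX_generator R V e r k).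
Proof.
move=> r0 lec F G FG A.
have split H : EX_generator e r H A + c * H A =
    2^-1 * (\sum_x \sum_(y | e x y) r x y * H (swap x y A)) +
    (c - 2^-1 * \sum_x \sum_(y | e x y) r x y) * H A.
  rewrite /EX_generator.
  have -> : \sum_x \sum_(y | e x y) r x y * (H (swap x y A) - H A) =
      \sum_x \sum_(y | e x y) r x y * H (swap x y A) -
      (\sum_x \sum_(y | e x y) r x y) * H A.
    rewrite mulr_suml -sumrB; apply: eq_bigr => x _.
    by rewrite mulr_suml -sumrB; apply: eq_bigr => y _; rewrite mulrBr.
  by ring.
rewrite !split; apply: lerD; last by rewrite ler_wpM2l ?subr_ge0.
rewrite ler_pM2l ?invr_gt0//; apply: ler_sum => x _; apply: ler_sum => y exy.
by rewrite ler_wpM2l// r0.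
Qed.

Lemma RW_shift_monotone (R : realType) (V : finType) (e : rel V) (r : V -> V -> R)
    (c : R) :
  (forall x y, e x y -> 0 <= r x y) ->
  (forall x, \sum_(y | e x y) r x y <= c) ->
  shift_monotone c (RW_generator e r).
Proof.
move=> r0 lec F G FG x.
have split H : RW_generator e r H x + c * H x =
    \sum_(y | e x y) r x y * H y + (c - \sum_(y | e x y) r x y) * H x.
  rewrite /RW_generator; under eq_bigr do rewrite mulrBr.
  by rewrite sumrB -mulr_suml; ring.
rewrite !split; apply: lerD; last by rewrite ler_wpM2l ?subr_ge0.
by apply: ler_sum => y exy; rewrite ler_wpM2l// r0.
Qed.

Lemma sum_edge_sym (R : realType) (V : finType) (e : rel V) (h : V -> V -> R) :
  symmetric e ->
  \sum_x \sum_(y | e x y) h x y = \sum_x \sum_(y | e x y) h y x.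
Proof.
move=> e_sym; rewrite (exchange_big_dep xpredT)//=; apply: eq_bigr => y _.
by apply: eq_bigl => x; rewrite e_sym.
Qed.

Lemma half_double (R : realType) (z : R) : 2^-1 * (z + z) = z.
Proof. by field. Qed.

Section exclusion.
Context (R : realType) (V : finType) (e : rel V) (r : V -> V -> R) (k : nat).
Hypotheses (e_sym : symmetric e) (r_sym : forall x y, r x y = r y x).
Hypothesis r_ge0 : forall x y, e x y -> 0 <= r x y.
Local Notation EX := (@EX_generator R V e r k).
Local Notation RW := (RW_generator e r).

Lemma RW_sum0 (g : V -> R) : \sum_x RW g x = 0.
Proof.
have : \sum_x RW g x = - \sum_x RW g x.
  rewrite /RW_generator {1}sum_edge_sym// -sumrN; apply: eq_bigr => x _.
  by rewrite -sumrN; apply: eq_bigr => y _; rewrite (r_sym y); ring.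
by lra.
Qed.

Lemma semigroup_RW_sum (t : R) (g : V -> R) :
  \sum_x semigroup RW t g x = \sum_x g x.
Proof.
have L0 : linear_op (fun (_ : unit -> R) (_ : unit) => 0 : R).
  by move=> a F G; apply/funext => x; rewrite mulr0 addr0.
transitivity (\sum_x 1 * semigroup RW t g x).
  by apply: eq_bigr => x _; rewrite mul1r.
rewrite -(@semigroup_intertwine R V unit RW (fun _ _ => 0) (fun _ _ => 1) t g tt).
- rewrite (@semigroup_eigen _ _ _ _ 0)//; last first.
    by apply/funext => y; rewrite mul0r.
  by rewrite mulr0 expR0 mul1r; apply: eq_bigr => x _; rewrite mul1r.
- exact: RW_linear.
- move=> G; apply/funext => y; rewrite -[LHS](RW_sum0 G).
  by apply: eq_bigr => x _; rewrite mul1r.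
Qed.

(** A swap along an edge with two occupied endpoints changes nothing, but in the
    sum over particles the two contributions of such an edge cancel as well;
    hence the interaction is invisible to one-particle functions. *)
Lemma EX_occ_sum (g : V -> R) : EX (occ_sum g) = occ_sum (RW g).
Proof.
apply/funext => A; rewrite /EX_generator.
pose h x y := (x \in val A)%:R * (r x y * (g y - g x)).
have -> : \sum_x \sum_(y | e x y) r x y * (occ_sum g (swap x y A) - occ_sum g A) =
    \sum_x \sum_(y | e x y) h x y + \sum_x \sum_(y | e x y) h y x.
  rewrite -big_split/=; apply: eq_bigr => x _; rewrite -big_split/=.
  by apply: eq_bigr => y _; rewrite occ_sum_swap /h (r_sym y); ring.
rewrite (sum_edge_sym (fun x y => h y x) e_sym)/= half_double.
by apply: eq_bigr => x _; rewrite mulr_sumr.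
Qed.

Lemma semigroup_EX_occ_sum (t : R) (g : V -> R) :
  semigroup EX t (occ_sum g) = occ_sum (semigroup RW t g).
Proof.
apply/funext => A; pose w (B : config V k) x : R := (x \in val B)%:R.
exact: (@semigroup_intertwine _ _ _ RW EX w t g A (@RW_linear _ _ _ _) EX_occ_sum).
Qed.

Lemma semigroup_RW_ge0 (t : R) (g : V -> R) (x : V) :
  0 <= t -> (forall y, 0 <= g y) -> 0 <= semigroup RW t g x.
Proof.
move=> t0 g0; rewrite -law_at_expectation; last exact: RW_linear.
apply: sumr_ge0 => y _; rewrite mulr_ge0//.
apply: (@law_at_ge0 _ _ _ (\sum_x \sum_(y | e x y) r x y)) => //.
  exact: RW_linear.
apply: RW_shift_monotone => // z; rewrite [leRHS](bigD1 z)//= lerDl.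
by apply: sumr_ge0 => u _; apply: sumr_ge0 => v; exact: r_ge0.
Qed.

(** This is the sum of [f x * f y] over the ordered pairs of distinct occupied
    sites: removing the diagonal is what makes the inequality below hold. *)
Definition pair_sum (f : V -> R) (A : config V k) : R :=
  occ_sum f A ^+ 2 - occ_sum (fun x => f x ^+ 2) A.

(** The generator applied to a square is [2 F L F] plus the carre du champ. The
    latter weighs an edge by [([x in A] - [y in A]) ^ 2], whereas removing the
    diagonal subtracts the weight [[x in A] + [y in A]], which is at least as
    large. *)
Lemma EX_pair_sum (a : R) (f : V -> R) (A : config V k) :
  (forall x, - RW f x = a * f x) ->
  EX (pair_sum f) A <= - (2 * a) * pair_sum f A.
Proof.
move=> f_eigen.
pose d x y := ((x \in val A)%:R - (y \in val A)%:R) * (f y - f x).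
pose G x := \sum_(y | e x y) r x y * (f y - f x) ^+ 2.
have E1 : EX (pair_sum f) A = 2 * occ_sum f A * EX (occ_sum f) A
    + 2^-1 * (\sum_x \sum_(y | e x y) r x y * d x y ^+ 2)
    - EX (occ_sum (fun x => f x ^+ 2)) A.
  rewrite /EX_generator !(mulrCA _ 2^-1) -mulrDr -mulrBr; congr (_ * _).
  rewrite mulr_sumr -big_split -sumrB/=; apply: eq_bigr => x _.
  rewrite mulr_sumr -big_split -sumrB/=; apply: eq_bigr => y _.
  rewrite /pair_sum; have := occ_sum_swap f x y A; rewrite -/(d x y).
  move/(canRL (subrK _)) => ->; ring.
have E2 x : RW (fun x => f x ^+ 2) x = - (2 * a) * f x ^+ 2 + G x.
  transitivity (2 * f x * RW f x + G x).
    rewrite /RW_generator /G mulr_sumr -big_split/=.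
    by apply: eq_bigr => y _; ring.
  by rewrite -[RW f x]opprK f_eigen; ring.
have E3 : occ_sum (RW f) A = - a * occ_sum f A.
  rewrite /occ_sum mulr_sumr; apply: eq_bigr => x _.
  by rewrite -[RW f x]opprK f_eigen; ring.
have E4 : occ_sum (RW (fun x => f x ^+ 2)) A =
    - (2 * a) * occ_sum (fun x => f x ^+ 2) A + occ_sum G A.
  by rewrite /occ_sum mulr_sumr -big_split/=; apply: eq_bigr => x _; rewrite E2; ring.
have le_G : 2^-1 * (\sum_x \sum_(y | e x y) r x y * d x y ^+ 2) <= occ_sum G A.
  pose h x y := (x \in val A)%:R * (r x y * (f y - f x) ^+ 2).
  have -> : occ_sum G A = 2^-1 *
      (\sum_x \sum_(y | e x y) h x y + \sum_x \sum_(y | e x y) h y x).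
    rewrite (sum_edge_sym (fun x y => h y x) e_sym)/= half_double.
    by apply: eq_bigr => x _; rewrite mulr_sumr.
  rewrite ler_pM2l ?invr_gt0// -big_split/=; apply: ler_sum => x _.
  rewrite -big_split/=; apply: ler_sum => y exy.
  have -> : h x y + h y x =
      r x y * (((x \in val A)%:R + (y \in val A)%:R) * (f y - f x) ^+ 2).
    by rewrite /h (r_sym y); ring.
  rewrite ler_wpM2l ?r_ge0// /d exprMn ler_wpM2r ?sqr_ge0//.
  by case: (_ \in _); case: (_ \in _); rewrite ?mulr1n ?mulr0n; lra.
rewrite E1 !EX_occ_sum E3 E4 /pair_sum; lra.
Qed.

Lemma swapK (x y : V) : involutive (@swap V k x y).
Proof.
move=> A; apply: val_inj; rewrite !SubK -imset_comp.
by rewrite (eq_imset _ (tpermK x y)) imset_id.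
Qed.

Lemma EX_sum0 (F : config V k -> R) : \sum_A EX F A = 0.
Proof.
rewrite /EX_generator -mulr_sumr exchange_big/= big1 ?mulr0// => x _.
rewrite exchange_big/= big1// => y _; rewrite -mulr_sumr sumrB.
by rewrite [X in _ - X](reindex_inj (inv_inj (swapK x y))) subrr mulr0.
Qed.

(** The number of configurations containing a given site does not depend on the
    site, since [swap x y] exchanges those of [x] and of [y]. *)
Lemma sum_occ_sum (g : V -> R) :
  #|V|%:R * \sum_(A : config V k) occ_sum g A =
  k%:R * #|{: config V k}|%:R * \sum_x g x.
Proof.
pose N x : R := \sum_(A : config V k) (x \in val A)%:R.
have NE x y : N x = N y.
  rewrite /N (reindex_inj (inv_inj (swapK x y))); apply: eq_bigr => A _.
  by rewrite mem_swap tpermL.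
have sumN : \sum_x N x = k%:R * #|{: config V k}|%:R.
  rewrite exchange_big/= -sum1_card natr_sum mulr_sumr.
  apply: eq_bigr => A _; have /eqP cardA := valP A.
  rewrite mulr1 -[in RHS]cardA -sum1_card natr_sum [in RHS]big_mkcond/=.
  by apply: eq_bigr => x _; case: ifP.
rewrite exchange_big/= -sumN !mulr_sumr; apply: eq_bigr => x _.
rewrite -mulr_suml -/(N x) mulrA; congr (_ * _).
rewrite (eq_bigr (fun=> N x)) => [|y _]; last exact: NE.
by rewrite sumr_const mulr_natl.
Qed.

Lemma EX_law_ge0 (t : R) (A B : config V k) : 0 <= t -> 0 <= law_at EX t A B.
Proof.
move=> t0; apply: (@law_at_ge0 _ _ _ (2^-1 * \sum_x \sum_(y | e x y) r x y)) => //.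
  exact: EX_linear.
exact: EX_shift_monotone.
Qed.

Lemma EX_law_mass (t : R) (A : config V k) : \sum_B law_at EX t A B = 1.
Proof.
apply: law_at_mass; first exact: EX_linear.
apply/funext => B; rewrite /EX_generator big1 ?mulr0// => x _.
by rewrite big1// => y _; rewrite subrr mulr0.
Qed.

(** The second moment splits into its off-diagonal part, which decays at rate
    [2 a] like the square of the mean, and its diagonal part, which is a
    one-particle quantity. *)
Lemma EX_variance (a t : R) (f : V -> R) (A : config V k) :
  0 <= a -> 0 <= t -> (forall x, - RW f x = a * f x) ->
  \sum_B law_at EX t A B * (occ_sum f B - expR (- (t * a)) * occ_sum f A) ^+ 2 <=
  occ_sum (semigroup RW t (fun x => f x ^+ 2)) A.
Proof.
move=> a0 t0 f_eigen; have EXlin := @EX_linear R V e r k.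
rewrite variance_eq; [|exact: EX_law_mass|]; last first.
  rewrite law_at_expectation// (@semigroup_eigen _ _ _ _ (- a))// ?mulrN//.
  rewrite EX_occ_sum; apply/funext => B; rewrite /occ_sum mulr_sumr.
  by apply: eq_bigr => x _; rewrite -[RW f x]opprK f_eigen; ring.
have -> : \sum_B law_at EX t A B * occ_sum f B ^+ 2 =
    semigroup EX t (pair_sum f) A + semigroup EX t (occ_sum (fun x => f x ^+ 2)) A.
  rewrite -!law_at_expectation// -big_split/=; apply: eq_bigr => B _.
  by rewrite /pair_sum; ring.
have : semigroup EX t (pair_sum f) A <= expR (- (t * (2 * a))) * pair_sum f A.
  pose c := 2^-1 * \sum_x \sum_(y | e x y) r x y.
  have c0 : 0 <= c.
    rewrite mulr_ge0// sumr_ge0// => x _.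
    by apply: sumr_ge0 => y; exact: r_ge0.
  apply: (@semigroup_decay _ _ _ (c + 2 * a)) => //.
  - by apply: EX_shift_monotone => //; rewrite -/c lerDl mulr_ge0.
  - by rewrite lerDr.
  - by move=> B; exact: EX_pair_sum.
have -> : expR (- (t * (2 * a))) = expR (- (t * a)) ^+ 2.
  by rewrite -expRM_natl; congr expR; ring.
have occ_f2 : 0 <= occ_sum (fun x => f x ^+ 2) A.
  by apply: sumr_ge0 => x _; rewrite mulr_ge0// sqr_ge0.
have := mulr_ge0 (sqr_ge0 (expR (- (t * a)))) occ_f2.
rewrite semigroup_EX_occ_sum exprMn /pair_sum mulrBr; lra.
Qed.

(** The generator has total sum zero, so summing [EX_pair_sum] over all states
    shows that [pair_sum f] has nonpositive total. *)
Lemma sum_occ_sum_sqr_le (a : R) (f : V -> R) :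
  0 < a -> (forall x, - RW f x = a * f x) ->
  \sum_(A : config V k) occ_sum f A ^+ 2 <=
  \sum_(A : config V k) occ_sum (fun x => f x ^+ 2) A.
Proof.
move=> a0 f_eigen; rewrite -subr_le0 -sumrB.
have a2 : 0 < 2 * a by rewrite mulr_gt0.
rewrite -(ler_pM2l a2) mulr0 -oppr_ge0 -mulNr mulr_sumr.
rewrite -[leLHS](EX_sum0 (pair_sum f)); apply: ler_sum => A _.
exact: EX_pair_sum.
Qed.

End exclusion.

(** * Choice of the initial state *)

(** Discarding a minimal element of [S] does not lower the average; repeat until
    [k] elements remain. *)
Lemma subset_above_average (R : realType) (V : finType) (h : V -> R)
    (S : {set V}) (k : nat) :
  (k <= #|S|)%N ->
  exists A : config V k, val A \subset S /\
    k%:R * \sum_(x in S) h x <= #|S|%:R * occ_sum h A.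
Proof.
move=> kS; have occE (A : config V k) : occ_sum h A = \sum_(x in val A) h x.
  rewrite /occ_sum [in RHS]big_mkcond/=; apply: eq_bigr => x _.
  by case: ifP; rewrite ?mul1r ?mul0r.
elim: {S}#|S| {-2}S (erefl #|S|) kS => [|s IH] S sS kS.
  have cS : #|S| == k by rewrite sS; move: kS; rewrite sS leqn0 eq_sym.
  by exists (Sub S cS); split; rewrite ?occE SubK// (eqP cS).
have [kS'|kS'] := eqVneq #|S| k.
  have cS : #|S| == k by apply/eqP.
  by exists (Sub S cS); split; rewrite ?occE SubK// (eqP cS).
have [x0 x0S] : exists x0, x0 \in S.
  by apply/set0Pn; rewrite -card_gt0 sS.
pose z := [arg min_(x < x0 | x \in S) h x]%O.
have [zS zmin] : z \in S /\ forall y, y \in S -> h z <= h y.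
  by rewrite /z; case: arg_minP.
have cardSz : #|S :\ z| = s.
  by move: sS; rewrite (cardsD1 z) zS => -[].
have [|A [AS hA]] := IH (S :\ z) cardSz; first by rewrite cardSz; lia.
exists A; split; first by apply: (fintype.subset_trans AS); exact: subsetDl.
have zle : s%:R * h z <= \sum_(x in S :\ z) h x.
  rewrite -cardSz -sum1_card natr_sum mulr_suml; apply: ler_sum => x.
  by rewrite mul1r => /setD1P[_ xS]; exact: zmin.
rewrite (big_setD1 z)//= sS; rewrite cardSz in hA.
set T := \sum_(x in S :\ z) h x in hA zle *.
have k_le_s : (k <= s)%N by lia.
have [s0|s0] := posnP s.
  have k0 : k = 0%N by lia.
  have /eqP := valP A; rewrite [in RHS]k0 => /eqP; rewrite cards_eq0 => /eqP A0.
  by rewrite occE A0 big_set0 mulr0 k0 mul0r.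
have sR : 0 < s%:R :> R by rewrite ltr0n.
rewrite -(ler_pM2l sR) -natr1.
apply: (@le_trans _ _ ((s%:R + 1) * (k%:R * T))).
  have := ler_wpM2l (ler0n R k) zle; lra.
by rewrite [leRHS]mulrCA ler_wpM2l// addr_ge0// ltW.
Qed.

(** The sets where [f] is nonnegative and negative carry opposite sums, and one
    of them has at least half of the sites. Squaring hides which one it is. *)
Lemma same_sign_set_half_l1 (R : realType) (V : finType) (f : V -> R) (k : nat) :
  (2 * k <= #|V|)%N -> \sum_x f x = 0 ->
  exists S : {set V}, (k <= #|S|)%N /\
    (\sum_(x in S) f x) ^+ 2 = (2^-1 * \sum_x `|f x|) ^+ 2.
Proof.
move=> kV f0; pose P := [set x | 0 <= f x]%SET.
have fP : \sum_(x in P) f x + \sum_(x in ~: P) f x = 0.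
  by rewrite -[RHS]f0 [in RHS](bigID (mem P))/=; congr (_ + _); apply: eq_bigl => x; rewrite inE.
have aP : \sum_x `|f x| = \sum_(x in P) f x - \sum_(x in ~: P) f x.
  rewrite (bigID (mem P))/= -sumrN; congr (_ + _).
    by apply: eq_bigr => x; rewrite inE => /ger0_norm.
  apply: eq_big => x; first by rewrite [in RHS]inE.
  by rewrite inE -ltNge => /ltr0_norm.
have [kP|kP] := leqP k #|P|.
  by exists P; split=> //; congr (_ ^+ 2); rewrite aP; lra.
exists (~: P); split; first by have := cardsC P; lia.
by rewrite -[LHS]sqrrN; congr (_ ^+ 2); rewrite aP; lra.
Qed.

(** In the tangent bound [2 M F - M ^ 2 <= F ^ 2], [M] is the mean of [F] over
    uniform [k]-subsets of the chosen set [S] of size [s]. The constant 8 comes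
    from [M ^ 2 = (k l1 / 2 s) ^ 2] and from [1 / s + 1 / n <= 2 n / s ^ 2], which
    uses only [s <= n]. *)
Lemma exists_good_start (R : realType) (V : finType) (f w : V -> R) (k : nat)
    (c : R) :
  (0 < k)%N -> (2 * k <= #|V|)%N -> \sum_x f x = 0 ->
  (forall x, 0 <= w x) -> \sum_x w x = \sum_x f x ^+ 2 -> 0 <= c ->
  8 * c * #|V|%:R * \sum_x f x ^+ 2 <= k%:R * (\sum_x `|f x|) ^+ 2 ->
  exists A : config V k,
    c * (occ_sum w A + k%:R / #|V|%:R * \sum_x f x ^+ 2) <= occ_sum f A ^+ 2.
Proof.
move=> k0 kV f0 w0 sw c0 hc.
have [S [kS fS]] := same_sign_set_half_l1 kV f0.
set T := \sum_(x in S) f x in fS.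
set N1 := \sum_x `|f x| in hc fS; set N2 := \sum_x f x ^+ 2 in hc sw *.
have kR : 0 < k%:R :> R by rewrite ltr0n.
have sR : 0 < #|S|%:R :> R by rewrite ltr0n; lia.
have sn : #|S|%:R <= #|V|%:R :> R by rewrite ler_nat max_card.
have avg := subset_above_average _ kS.
set s : R := #|S|%:R in sR sn avg; set n : R := #|V|%:R in sn hc *.
set kk : R := k%:R in kR hc avg *.
pose M := kk * T / s.
have [A [_ hA]] := avg _ (fun x => 2 * M * f x - c * w x).
exists A.
have occh : occ_sum (fun x => 2 * M * f x - c * w x) A = 2 * M * occ_sum f A - c * occ_sum w A.
  by rewrite /occ_sum !mulr_sumr -sumrB; apply: eq_bigr => x _; ring.
rewrite occh sumrB -!mulr_sumr -/T in hA.
have wS : \sum_(x in S) w x <= N2.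
  by rewrite -sw [leRHS](bigID (mem S))/= lerDl; apply: sumr_ge0.
have N20 : 0 <= N2 by apply: sumr_ge0 => x _; exact: sqr_ge0.
set W := occ_sum w A in hA *; set F := occ_sum f A in hA *.
have n0 : 0 < n by exact: lt_le_trans sR sn.
have hA1 : 2 * M ^+ 2 - c * kk * N2 / s <= 2 * M * F - c * W.
  rewrite -(ler_pM2l sR); apply: le_trans hA.
  have -> : s * (2 * M ^+ 2 - c * kk * N2 / s) = kk * (2 * M * T - c * N2).
    by rewrite /M; field; rewrite gt_eqF.
  by rewrite ler_pM2l// lerD2l lerN2 ler_wpM2l.
have M2 : c * kk * N2 * (s^-1 + n^-1) <= M ^+ 2.
  rewrite /M !exprMn fS.
  apply: (@le_trans _ _ (2 * c * kk * N2 * n / s ^+ 2)).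
    rewrite -subr_ge0 [X in 0 <= X](_ : _ =
      c * kk * N2 * (n - s) * (2 * n + s) / (n * s ^+ 2)); last first.
      by field; rewrite !gt_eqF.
    have := subr_ge0 s n; rewrite sn => ns.
    by rewrite divr_ge0// ?mulr_ge0// ?addr_ge0 ?ltW// ?mulr_gt0 ?exprn_gt0.
  rewrite exprVn; apply: ler_wpM2r; first by rewrite invr_ge0 sqr_ge0.
  rewrite [leRHS](_ : _ = kk * (kk * N1 ^+ 2) / 4); last by field.
  rewrite (_ : 2 * c * kk * N2 * n = kk * (8 * c * n * N2) / 4); last by field.
  by rewrite ler_pM2r// ler_pM2l.
have sq : 2 * M * F - M ^+ 2 <= F ^+ 2.
  by rewrite -subr_ge0 (_ : _ - _ = (F - M) ^+ 2) ?sqr_ge0//; ring.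
have -> : c * (W + kk / n * N2) = c * W + c * kk * N2 / n by field; rewrite gt_eqF.
move: M2; rewrite mulrDr; lra.
Qed.

(** * The mixing time *)

Lemma Lpnorm1E (R : realType) (V : finType) (f : V -> R) :
  Lpnorm 1 f = #|V|%:R^-1 * \sum_x `|f x|.
Proof.
rewrite /Lpnorm /uniform_law invr1 -mulr_sumr powRr1.
  by congr (_ * _); apply: eq_bigr => x _; rewrite powRr1.
by rewrite mulr_ge0// sumr_ge0// => x _; exact: powR_ge0.
Qed.

Lemma Lpnorm2_sqr (R : realType) (V : finType) (f : V -> R) :
  Lpnorm 2 f ^+ 2 = #|V|%:R^-1 * \sum_x f x ^+ 2.
Proof.
have sqrE x : `|f x| `^ 2 = f x ^+ 2 by rewrite powR_mulrn// real_normK ?num_real.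
rewrite /Lpnorm /uniform_law -mulr_sumr (eq_bigr (fun x => f x ^+ 2)) => [|x _]; last exact: sqrE.
rewrite powR12_sqrt ?sqr_sqrtr// mulr_ge0// sumr_ge0// => x _; exact: sqr_ge0.
Qed.

(** The hypothesis on [c] lets [exists_good_start] bound the sum of the two second
    moments by [F(A) ^ 2 / c]; a distance of at most [1 - eps] would then give
    [eps * m ^ 2 <= 2 F(A) ^ 2 / c], contrary to the hypothesis on [t]. The
    starting point [A] depends on [t]. *)
Lemma EX_far_from_stationary (R : realType) (V : finType) (e : rel V)
    (r : V -> V -> R) (k : nat) (a : R) (f : V -> R) (c eps t : R) :
  symmetric e -> (forall x y, r x y = r y x) ->
  (forall x y, e x y -> 0 <= r x y) ->
  0 < a -> (forall x, - RW_generator e r f x = a * f x) ->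
  (exists x, f x != 0) -> (0 < k)%N -> (2 * k <= #|V|)%N -> 0 < c -> 0 <= t ->
  8 * c * #|V|%:R * \sum_x f x ^+ 2 <= k%:R * (\sum_x `|f x|) ^+ 2 ->
  2 < eps * c * expR (- (t * a)) ^+ 2 ->
  exists A, 1 - eps < tv_dist (law_at (@EX_generator R V e r k) t A)
                              (@uniform_law R (config V k)).
Proof.
move=> e_sym r_sym r_ge0 a0 f_eigen [x0 fx0] k0 kV c0 t0 l1_large decay.
have kR0 : 0 < k%:R :> R by rewrite ltr0n.
have nR0 : 0 < #|V|%:R :> R by rewrite ltr0n; lia.
have sum_f0 : \sum_x f x = 0.
  have : - a * \sum_x f x = 0.
    rewrite -[RHS](RW_sum0 e_sym r_sym f) mulr_sumr; apply: eq_bigr => x _.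
    by rewrite mulNr -f_eigen opprK.
  by move/eqP; rewrite mulf_eq0 oppr_eq0 gt_eqF//= => /eqP.
set N2 := \sum_x f x ^+ 2 in l1_large *.
have N2_gt0 : 0 < N2.
  rewrite /N2 (bigD1 x0)//= ltr_wpDr ?exprn_even_gt0//.
  by apply: sumr_ge0 => x _; exact: sqr_ge0.
pose w := semigroup (RW_generator e r) t (fun x => f x ^+ 2).
have w_ge0 x : 0 <= w x.
  by apply: semigroup_RW_ge0 => // y; exact: sqr_ge0.
have [A hA] : exists A : config V k,
    c * (occ_sum w A + k%:R / #|V|%:R * N2) <= occ_sum f A ^+ 2.
  by apply: exists_good_start => //; [exact: semigroup_RW_sum|exact: ltW].
exists A; rewrite ltNge; apply/negP => tmix.
pose m := expR (- (t * a)) * occ_sum f A.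
have stationary : \sum_B @uniform_law R (config V k) B * occ_sum f B ^+ 2 <=
    k%:R / #|V|%:R * N2.
  have C0 : 0 < #|{: config V k}|%:R :> R.
    by rewrite ltr0n; apply/card_gt0P; exists A.
  rewrite -mulr_sumr.
  apply: (@le_trans _ _ (#|{: config V k}|%:R^-1 *
     \sum_(B : config V k) occ_sum (fun x => f x ^+ 2) B)).
    rewrite ler_pM2l ?invr_gt0//.
    exact: (sum_occ_sum_sqr_le k e_sym r_sym r_ge0 a0 f_eigen).
  rewrite -(ler_pM2l nR0) mulrCA sum_occ_sum -/N2.
  rewrite le_eqVlt; apply/orP; left; apply/eqP.
  by field; rewrite !gt_eqF.
have unif0 B : 0 <= @uniform_law R (config V k) B by rewrite invr_ge0.
have tv := tv_dist_second_moment (occ_sum f) m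
   (fun B => EX_law_ge0 r_ge0 A B t0) unif0 (EX_law_mass e r t A).
have var := EX_variance e_sym r_sym r_ge0 A (ltW a0) t0 f_eigen.
rewrite -/w -/m in var.
set W := occ_sum w A + k%:R / #|V|%:R * N2 in hA.
have W0 : 0 < W.
  rewrite ltr_wpDl ?mulr_gt0 ?invr_gt0//.
  by apply: sumr_ge0 => x _; rewrite mulr_ge0.
have eps_tv : eps * m ^+ 2 <= 2 * W.
  apply: le_trans (_ : _ <= 2 * _ + 2 * _) _; last first.
    by rewrite -mulrDr ler_pM2l//; exact: lerD var stationary.
  apply: le_trans tv; rewrite ler_wpM2r ?sqr_ge0//.
  by rewrite lerBrDr -lerBrDl.
have F2 : 0 < occ_sum f A ^+ 2 by apply: lt_le_trans hA; rewrite mulr_gt0.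
have : 2 * occ_sum f A ^+ 2 < 2 * (c * W).
  apply: (@lt_le_trans _ _ (c * (eps * m ^+ 2))).
    rewrite /m exprMn [ltRHS](_ : _ = eps * c * expR (- (t * a)) ^+ 2 * occ_sum f A ^+ 2).
      by rewrite ltr_pM2r.
    by ring.
  by rewrite [leRHS]mulrCA ler_pM2l.
by rewrite ltr_pM2l// ltNge hA.
Qed.

(** The hypothesis on the norms gives the exponent [1 / 2 + 2 delta] of [kk], which
    is at least [4 delta] because [delta <= 1 / 4]. *)
Lemma l1_large_of_Lpnorm (R : realType) (V : finType) (f : V -> R) (kk delta : R) :
  1 <= kk -> delta <= 1 / 4 -> (0 < #|V|)%N ->
  kk `^ (- (1 / 4) + delta) * Lpnorm 2 f <= Lpnorm 1 f ->
  kk `^ (4 * delta) * #|V|%:R * \sum_x f x ^+ 2 <= kk * (\sum_x `|f x|) ^+ 2.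
Proof.
move=> kk1 delta4 n_gt0 f_norms.
have kk0 : 0 < kk by exact: lt_le_trans kk1.
have n0 : 0 < #|V|%:R :> R by rewrite ltr0n.
set N1 := \sum_x `|f x|; set N2 := \sum_x f x ^+ 2; set n : R := #|V|%:R.
have squared (l1 l2 : R) : 0 <= l2 -> kk `^ (- (1 / 4) + delta) * l2 <= l1 ->
    kk `^ ((- (1 / 4) + delta) * 2) * l2 ^+ 2 <= l1 ^+ 2.
  move=> l20 h; have p0 := powR_ge0 kk (- (1 / 4) + delta).
  rewrite powRrM powR_mulrn// -exprMn; apply: lerXn2r => //; rewrite nnegrE.
    exact: mulr_ge0.
  by apply: le_trans h; exact: mulr_ge0.
have := squared _ _ (powR_ge0 _ _) f_norms.
rewrite [X in _ * X](Lpnorm2_sqr f) [X in X ^+ 2](Lpnorm1E f) exprMn -/N1 -/N2 -/n => h.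
have {}h : kk `^ ((- (1 / 4) + delta) * 2) * n * N2 <= N1 ^+ 2.
  rewrite -(@ler_pM2l _ (n^-1 ^+ 2)) ?exprn_gt0 ?invr_gt0//.
  apply: le_trans h; rewrite le_eqVlt; apply/orP; left; apply/eqP.
  by field; rewrite gt_eqF.
apply: (@le_trans _ _ (kk * (kk `^ ((- (1 / 4) + delta) * 2) * n * N2))); last first.
  by rewrite ler_pM2l.
have N20 : 0 <= N2 by apply: sumr_ge0 => x _; exact: sqr_ge0.
rewrite !mulrA ler_wpM2r// ler_wpM2r ?(ltW n0)//.
rewrite -{2}(powRr1 (ltW kk0)) -powRD; last first.
  by apply/implyP => _; rewrite gt_eqF.
by apply: ler_powR => //; clear - delta4; lra.
Qed.

Theorem theorem1p4 (R : realType) (V : finType) (e : rel V) (r : V -> V -> R)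
  (e_sym : symmetric e) (e_irr : irreflexive e)
  (e_conn : forall x y : V, connect e x y)
  (r_sym : forall x y : V, r x y = r y x)
  (r_gt0 : forall x y : V, e x y -> 0 < r x y)
  (lambda : R) (f : V -> R)
  (lambda_gt0 : 0 < lambda)
  (f_neq0 : f <> (fun=> 0))
  (f_eigen : forall x : V, - RW_generator e r f x = lambda * f x)
  (eps delta : R) (k : nat)
  (eps_in : 0 < eps < 1 / 4) (delta_in : 0 < delta < 1 / 4)
  (k_le : (2 * k <= #|V|)%N)
  (f_norms : Lpnorm 1 f >= k%:R `^ (- (1 / 4) + delta) * Lpnorm 2 f)
  (log_ge0 : 4 * delta * ln k%:R - ln (16 / eps) >= 0) :
  ((1 / (2 * lambda) * (4 * delta * ln k%:R - ln (16 / eps)))%:E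
     <= tmix_EX e r k (1 - eps))%E.
Proof.
have /andP[eps0 eps4] := eps_in; have /andP[delta0 delta4] := delta_in.
have lnk0 : 0 < ln (k%:R : R).
  have eps16 : 1 < 16 / eps.
    by rewrite ltr_pdivlMr//; clear - eps4; lra.
  have : 0 < 4 * delta * ln (k%:R : R).
    by apply: lt_le_trans (ln_gt0 eps16) _; rewrite -subr_ge0.
  by rewrite pmulr_rgt0// mulr_gt0.
have k1 : (1 < k)%N.
  rewrite ltnNge; apply/negP => k1; move: lnk0.
  by case: k k1 {k_le f_norms log_ge0} => [|[|//]] _;
    [rewrite ln0// ?ltxx|rewrite ln1 ltxx].
have kd0 : 0 < (k%:R : R) `^ (4 * delta) by rewrite powR_gt0// ltr0n ltnW.
have c0 : 0 < (k%:R : R) `^ (4 * delta) / 8 by rewrite divr_gt0.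
rewrite /tmix_EX /mixing_time; apply: le_ereal_inf_tmp => _ [t [t0 tmix] <-].
rewrite lee_fin leNgt; apply/negP => t_lt.
(* With this constant, [eps * c] is twice the exponential of the quantity
   compared with [2 * lambda * t]. *)
have [|||A far] := @EX_far_from_stationary R V e r k lambda f
   (k%:R `^ (4 * delta) / 8) eps t e_sym r_sym (fun x y h => ltW (r_gt0 x y h))
   lambda_gt0 f_eigen _ (ltnW k1) k_le c0 t0.
- apply: contra_notP f_neq0 => /forallNP f0; apply/funext => x.
  by apply/eqP/negPn/negP; exact: f0.
- rewrite [8 * _]mulrC divfK ?pnatr_eq0//; apply: l1_large_of_Lpnorm => //.
  + by rewrite ler1n ltnW.
  + exact: ltW.
  + by apply: leq_trans k_le; rewrite muln_gt0 (ltnW k1).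
- rewrite -expRM_natl.
  have -> : eps * (k%:R `^ (4 * delta) / 8) =
      2 * expR (4 * delta * ln k%:R - ln (16 / eps)).
    rewrite expRB lnK ?posrE ?divr_gt0// /powR gt_eqF ?ltr0n ?(ltnW k1)//.
    by field; rewrite gt_eqF.
  rewrite -mulrA -expRD ltr_pMr// -[ltLHS]expR0 ltr_expR.
  move: t_lt; rewrite mulrC mul1r ltr_pdivlMr ?mulr_gt0//.
  by clear; lra.
- by move: far; rewrite ltNge tmix.
Qed.
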